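(* Let $(V,R)=\bigoplus_{i=1}^k (V_i,R_{\varphi_i})$ be a model space with $\ker R=0$, where each $\varphi_i$ is a symmetric bilinear form on $V_i$. Let $A\in G_R$. Then there exists a permutation $\sigma\in S_k$ such that $A(V_i)\subseteq V_{\sigma(i)}$ for every $i=1,\dots,k$.
   Context: All vector spaces are real and finite-dimensional. An algebraic curvature tensor on $V$ is a 4-linear form $R:V^4\to\mathbb{R}$ with $R(x,y,z,w)=-R(y,x,z,w)$, $R(x,y,z,w)=R(z,w,x,y)$ and $R(x,y,z,w)+R(x,z,w,y)+R(x,w,y,z)=0$. For a symmetric bilinear form $\varphi$, $R_\varphi(x,y,z,w)=\varphi(x,w)\varphi(y,z)-\varphi(x,z)\varphi(y,w)$; this is an algebraic curvature tensor. Writing $(V,R)=\bigoplus_{i=1}^k (V_i,R_i)$ means: $R$ is an algebraic curvature tensor on $V$, $V=V_1\oplus\cdots\oplus V_k$ with $\dim V_i\ge 1$, $R(x,y,z,w)=0$ for all $z,w\in V$ whenever $x\in V_i$, $y\in V_j$ with $i\neq j$, and the restriction of $R$ to $V_i$ is $R_i$. (Equivalently $R(x,y,z,w)=\sum_i R_i(x_i,y_i,z_i,w_i)$, where $x_i$ denotes the $V_i$-component of $x$, etc.) $\ker R=\{v\in V: R(v,x,y,z)=0\ \text{for all } x,y,z\in V\}$. $G_R=\{A\in GL(V): R(Ax,Ay,Az,Aw)=R(x,y,z,w)\ \text{for all } x,y,z,w\in V\}$. $S_k$ is the group of permutations of $\{1,\dots,k\}$. *)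

(* Defs.v *)
From HB Require Import structures.
From mathcomp Require Import all_boot all_order all_algebra all_fingroup.
From mathcomp Require Import boolp classical_sets reals.

Set Implicit Arguments.
Unset Strict Implicit.
Unset Printing Implicit Defensive.

Import GRing.Theory Num.Theory.
Local Open Scope ring_scope.
Local Open Scope classical_set_scope.

Definition form4 (K : realType) (V : vectType K) := V -> V -> V -> V -> K.

Definition multilinear4 (K : realType) (V : vectType K) (R : form4 V) : Prop :=
  [/\ forall y z w, scalar (fun x => R x y z w),
      forall x z w, scalar (fun y => R x y z w),
      forall x y w, scalar (fun z => R x y z w)
    & forall x y z, scalar (fun w => R x y z w)].

Definition alg_curv_tensor (K : realType) (V : vectType K) (R : form4 V) : Prop :=
  [/\ multilinear4 R,
      forall x y z w, R x y z w = - R y x z w,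
      forall x y z w, R x y z w = R z w x y
    & forall x y z w, R x y z w + R x z w y + R x w y z = 0].

Definition curv_of (K : realType) (V : vectType K) (phi : {symmetric V}) :
    form4 V :=
  fun x y z w => phi x w * phi y z - phi x z * phi y w.

Definition curv_ker (K : realType) (V : vectType K) (R : form4 V) : set V :=
  [set v | forall x y z, R v x y z = 0].

(* GL(V) is rendered as the bijective elements of [End(V)]. *)
Definition structure_group (K : realType) (V : vectType K) (R : form4 V) :
    set 'End(V) :=
  [set A | bijective A /\
           forall x y z w, R (A x) (A y) (A z) (A w) = R x y z w].

(* (V, R) = \bigoplus_i (Vs i, Rs i), an internal direct sum; [vsval] is the
   inclusion of the subspace [Vs i] into V. *)
Definition model_direct_sum (K : realType) (V : vectType K) (R : form4 V)
    (k : nat) (Vs : 'I_k -> {vspace V})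
    (Rs : forall i, form4 (subvs_of (Vs i))) : Prop :=
  [/\ alg_curv_tensor R,
      (\sum_(i < k) Vs i)%VS = fullv /\ directv (\sum_(i < k) Vs i)%VS,
      forall i, (1 <= \dim (Vs i))%N,
      forall i j x y z w, i != j -> x \in Vs i -> y \in Vs j -> R x y z w = 0
    & forall i (x y z w : subvs_of (Vs i)),
        R (vsval x) (vsval y) (vsval z) (vsval w) = Rs i x y z w].

(* Main.v *)
Require Import Defs.
From HB Require Import structures.
From mathcomp Require Import all_boot all_order all_algebra all_fingroup.
From mathcomp Require Import boolp classical_sets reals.

Set Implicit Arguments.
Unset Strict Implicit.
Unset Printing Implicit Defensive.

Import GRing.Theory Num.Theory.
Local Open Scope ring_scope.
Local Open Scope classical_set_scope.

(** Everything is read off from the relation [R x y _ _ = 0] between vectors,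
    which [G_R] preserves.  Write [x_i] for the components of [x] and [N(x)]
    for the set of all [y] with [R x y _ _ = 0].  As [ker R = 0], each [phi_i]
    is nondegenerate, so two vectors of one block [V_i] are related only if
    they are proportional ([curv_of_annihilator_line]), while vectors of
    different blocks are always related.

    Let [x] be a nonzero vector of [V_i], let [A] be in [G_R], and choose [m]
    with [u = (A x)_m] nonzero.  Everything related to [A x] is related to [u]
    ([annihilator_block_proj]), hence [N(x)] is contained in [N(y)] where
    [y = A^-1 u].  But [N(x)] contains [x] and all [V_j] with [j != i].  The
    latter forces [y] to lie in [V_i] ([mem_block_of_annihilator]), and then
    [x] in [N(y)] forces [y = c x].  So [u = c (A x)] with [u != 0], and [A x]
    lies in [V_m] ([structure_group_block_vector]).

    The index [m] is the same for all [x] in [V_i], because two nonproportional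
    vectors of [V_i] are unrelated, and so their images cannot lie in different
    blocks.  Finally [i |-> m] is injective: if [A] sent [V_i] and [V_j] into
    the same [V_m], then nonzero vectors of [V_i] and [V_j] would be related,
    so their images would be proportional, and so would they. *)

(** * Linear algebra of a single block *)

Lemma scalar_sum (K : nzRingType) (V : lmodType K) (f : V -> K) (I : finType)
    (E : I -> V) : scalar f -> f (\sum_i E i) = \sum_i f (E i).
Proof.
move=> lin_f; apply: big_morph => [u v|].
  by rewrite -{1}(scale1r u) lin_f mul1r.
by have := lin_f (-1) 0 0; rewrite scaler0 addr0 mulN1r addNr.
Qed.

(** If [phi x w <> 0], then vanishing of [R_phi x y _ w] says that
    [phi x w *: y - phi y w *: x] is orthogonal to everything. *)
Lemma curv_of_annihilator_line (K : realType) (U : vectType K)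
    (phi : {symmetric U}) (x y : U) :
    (forall v, (forall w, phi v w = 0) -> v = 0) ->
    x != 0 -> (forall z w, curv_of phi x y z w = 0) ->
  exists c, y = c *: x.
Proof.
move=> nondeg nz_x annih.
have [w nz_xw]: exists w, phi x w != 0.
  apply: contrapT => all0; case/eqP: nz_x; apply: nondeg => w.
  by apply/eqP; apply: contrapT => /negP nz; apply: all0; exists w.
exists ((phi x w)^-1 * phi y w).
rewrite -scalerA; apply: (scalerI nz_xw); rewrite [RHS]scalerA mulfV // scale1r.
apply/eqP; rewrite -subr_eq0; apply/eqP/nondeg => z.
by rewrite linearBl !linearZl_LR /= (mulrC (phi y w)); apply: (annih z w).
Qed.

(** * Components of a curvature tensor along a block decomposition *)

Section BlockDecomposition.

Variables (K : realType) (V : vectType K) (R : form4 V).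
Variables (k : nat) (Vs : 'I_k -> {vspace V}).
Hypothesis R_curv : alg_curv_tensor R.
Hypothesis sumVs : (\sum_(i < k) Vs i)%VS = fullv.
Hypothesis R_cross : forall i j x y z w,
  i != j -> x \in Vs i -> y \in Vs j -> R x y z w = 0.

Definition block_proj (i : 'I_k) : 'End(V) := sumv_pi (\sum_(i < k) Vs i)%VS i.

Lemma mem_block_proj i v : block_proj i v \in Vs i.
Proof. exact: memv_sum_pi. Qed.

Lemma sum_block_proj v : v = \sum_i block_proj i v.
Proof. by rewrite sumv_pi_sum // sumVs memvf. Qed.

Lemma mem_block_of_proj i v :
  (forall j, j != i -> block_proj j v = 0) -> v \in Vs i.
Proof.
move=> v_j0; rewrite [v]sum_block_proj (bigD1 i) //= big1 // addr0.
exact: mem_block_proj.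
Qed.

Lemma curv_proj2 i v y z w : v \in Vs i -> R v y z w = R v (block_proj i y) z w.
Proof.
case: R_curv => -[_ lin2 _ _] _ _ _ Vi_v.
rewrite {1}[y]sum_block_proj (scalar_sum _ (lin2 v z w)) (bigD1 i) //=.
rewrite big1 ?addr0 // => j ne_ji.
by apply: (R_cross (i := i) (j := j)) => //; rewrite ?mem_block_proj 1?eq_sym.
Qed.

(** By the Bianchi identity, [R v a b w] is a combination of [R v b _ _] and
    [R a b _ _], which vanish for [b] in another block. *)
Lemma curv_proj3 i v a z w : v \in Vs i -> a \in Vs i ->
  R v a z w = R v a (block_proj i z) w.
Proof.
case: R_curv => -[_ _ lin3 _] _ pairsym bianchi Vi_v Vi_a.
rewrite {1}[z]sum_block_proj (scalar_sum _ (lin3 v a w)) (bigD1 i) //=.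
rewrite big1 ?addr0 // => j ne_ji.
have cross c : c \in Vs i -> forall t s, R c (block_proj j z) t s = 0.
  move=> Vi_c t s; apply: (R_cross (i := i) (j := j)) => //.
    by rewrite eq_sym.
  exact: mem_block_proj.
have := bianchi v a (block_proj j z) w.
by rewrite (pairsym v w) !cross // !addr0.
Qed.

Lemma curv_proj4 i v a z w : v \in Vs i -> a \in Vs i ->
  R v a z w = R v a z (block_proj i w).
Proof.
case: R_curv => _ antisym pairsym _ Vi_v Vi_a.
have swap c d : R v a c d = - R v a d c.
  by rewrite pairsym antisym pairsym.
by rewrite swap (curv_proj3 _ _ Vi_v Vi_a) -swap.
Qed.

Lemma curv_proj i v x y z : v \in Vs i ->
  R v x y z = R v (block_proj i x) (block_proj i y) (block_proj i z).
Proof.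
move=> Vi_v; rewrite (curv_proj2 _ _ _ Vi_v).
by rewrite (curv_proj3 _ _ Vi_v) ?mem_block_proj // -curv_proj4 ?mem_block_proj.
Qed.

(** Each [block_proj i] is self-adjoint for [R], because both sides are the
    value of [R] on the [i]-components of all four arguments.  This moves a
    projection off the two arguments that define the relation [R x y _ _ = 0]
    and onto the two arbitrary ones. *)
Lemma curv_block_proj i x y z w :
  R (block_proj i x) y z w = R x y (block_proj i z) (block_proj i w).
Proof.
case: R_curv => _ _ pairsym _.
have [Vi_z Vi_w] := (mem_block_proj i z, mem_block_proj i w).
rewrite (curv_proj _ _ _ (mem_block_proj i x)) pairsym [RHS]pairsym.
by rewrite -(curv_proj4 _ _ Vi_z Vi_w) -(curv_proj3 _ _ Vi_z Vi_w).
Qed.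

Lemma annihilator_block_proj m u y :
    (forall z w, R u y z w = 0) -> forall z w, R (block_proj m u) y z w = 0.
Proof. by move=> annih z w; rewrite curv_block_proj annih. Qed.

Hypothesis ker0 : forall v, (forall x y z, R v x y z = 0) -> v = 0.

(** The [j]-component of [y] is related to [V_j] by assumption and to every
    other block anyway, so it lies in the kernel. *)
Lemma mem_block_of_annihilator i y :
    (forall j v, j != i -> v \in Vs j -> forall z w, R y v z w = 0) ->
  y \in Vs i.
Proof.
move=> annih; apply: mem_block_of_proj => j ne_ji; apply: ker0 => v z w.
rewrite (curv_proj2 _ _ _ (mem_block_proj j y)).
apply: annihilator_block_proj => ? ?.
exact: annih ne_ji (mem_block_proj _ _) _ _.
Qed.

Lemma block_cap0 i j v : i != j -> v \in Vs i -> v \in Vs j -> v = 0.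
Proof.
move=> ne_ij Vi_v Vj_v; apply: ker0 => x y z.
rewrite (curv_proj2 _ _ _ Vi_v).
by apply: (R_cross (i := j) (j := i)); rewrite ?mem_block_proj 1?eq_sym.
Qed.

(** * The relation [R x y _ _ = 0] and the structure group *)

Section CanonicalBlocks.

Variable phi : forall i : 'I_k, {symmetric (subvs_of (Vs i))}.
Hypothesis R_phi : forall i (x y z w : subvs_of (Vs i)),
  R (vsval x) (vsval y) (vsval z) (vsval w) = curv_of (phi i) x y z w.

(** A vector of [V_i] orthogonal to [V_i] under [phi_i] lies in [ker R]:
    only the [i]-components of the other three arguments contribute. *)
Lemma block_form_nondegenerate i (v : subvs_of (Vs i)) :
  (forall w, phi i v w = 0) -> v = 0.
Proof.
move=> v_orth; apply: val_inj => /=; apply: ker0 => x y z.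
rewrite (curv_proj _ _ _ (subvsP v)).
rewrite -(vsprojK (mem_block_proj i x)) -(vsprojK (mem_block_proj i y)).
rewrite -(vsprojK (mem_block_proj i z)) R_phi /curv_of.
by rewrite !v_orth !mul0r subr0.
Qed.

Lemma block_annihilator_line i x y : x \in Vs i -> y \in Vs i ->
    x != 0 -> (forall z w, R x y z w = 0) -> exists c, y = c *: x.
Proof.
move=> Vi_x Vi_y nz_x annih.
have nz_px : vsproj (Vs i) x != 0.
  by apply: contra_neq nz_x => px0; rewrite -(vsprojK Vi_x) px0.
have [z w|c def_y] := curv_of_annihilator_line (y := vsproj (Vs i) y)
    (@block_form_nondegenerate i) nz_px.
  by rewrite -R_phi !vsprojK ?annih.
by exists c; rewrite -(vsprojK Vi_y) def_y linearZ /= vsprojK.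
Qed.

Variable A : 'End(V).
Hypothesis A_G : structure_group R A.

Lemma structure_group_inj : injective A.
Proof. by case: A_G => /bij_inj. Qed.

(** As [A] is onto, the two free arguments range over all of [V] on both
    sides. *)
Lemma structure_group_annihilator x y :
  (forall z w, R (A x) (A y) z w = 0) <-> (forall z w, R x y z w = 0).
Proof.
case: A_G => -[B AK BK] A_R; split=> annih z w; first by rewrite -A_R annih.
by rewrite -(BK z) -(BK w) A_R annih.
Qed.

(** Pulling a nonzero component [u] of [A x] back by [A] gives a vector [B u]
    that is related to at least as many vectors as [x], and a nonzero vector of
    a block only shares its relations with its own multiples.  So [u] is a
    multiple of [A x]. *)
Lemma structure_group_block_vector i x : x \in Vs i ->
  exists m, A x \in Vs m.
Proof.
case: (A_G) => -[B AK BK] _ Vi_x.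
have [->|nz_x] := eqVneq x 0; first by exists i; rewrite linear0 mem0v.
have [m nz_u]: exists m, block_proj m (A x) != 0.
  apply: contrapT => all0; case/eqP: nz_x; apply: structure_group_inj.
  rewrite linear0 [A x]sum_block_proj big1 // => m _.
  by apply/eqP; apply: contrapT => /negP nz; apply: all0; exists m.
exists m; set u := block_proj m (A x) in nz_u *.
have y_annih v : (forall z w, R x v z w = 0) -> forall z w, R (B u) v z w = 0.
  move=> annih; apply/structure_group_annihilator; rewrite BK.
  by apply: annihilator_block_proj; apply/structure_group_annihilator.
have Vi_y : B u \in Vs i.
  apply: mem_block_of_annihilator => j v ne_ji Vj_v; apply: y_annih => z w.
  by apply: (R_cross (i := i) (j := j)); rewrite // eq_sym.
have xy_annih z w : R x (B u) z w = 0.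
  case: R_curv => _ antisym _ _; rewrite antisym y_annih ?oppr0 // => z' w'.
  (* [R x x] is its own opposite *)
  by apply/eqP; rewrite -eqNr -antisym.
have [c def_y] := block_annihilator_line Vi_x Vi_y nz_x xy_annih.
have def_u : u = c *: A x by rewrite -(BK u) def_y linearZ.
have nz_c : c != 0 by apply: contra_neq nz_u => c0; rewrite def_u c0 scale0r.
rewrite -[A x]scale1r -(mulVf nz_c) -scalerA -def_u memvZ //.
exact: mem_block_proj.
Qed.

(** All vectors of [V_i] are compared with one nonzero vector [e]: those
    related to [e] are multiples of it, and the image of any other one is
    unrelated to [A e], hence cannot lie in another block. *)
Lemma structure_group_block i : exists m, (A @: Vs i <= Vs m)%VS.
Proof.
have [Vi0|nz_Vi] := eqVneq (Vs i) 0%VS.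
  by exists i; rewrite Vi0 limg0 sub0v.
have Vi_e := memv_pick (Vs i); set e := vpick _ in Vi_e.
have nz_e : e != 0 by rewrite vpick0.
have [m Vm_Ae] := structure_group_block_vector Vi_e.
exists m; apply/subvP => _ /memv_imgP[x Vi_x ->].
have [ex_annih|ex_rel] := pselect (forall z w, R e x z w = 0).
  have [c ->] := block_annihilator_line Vi_e Vi_x nz_e ex_annih.
  by rewrite linearZ memvZ.
have [m' Vm'_Ax] := structure_group_block_vector Vi_x.
have [->//|ne_mm'] := eqVneq m m'.
case: ex_rel; apply/structure_group_annihilator => z w.
exact: R_cross ne_mm' Vm_Ae Vm'_Ax.
Qed.

(** Vectors of [V_i] and [V_j] are related, so their images in [V_m] would be
    proportional, although [V_i] and [V_j] only meet in [0]. *)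
Lemma structure_group_block_inj i j m :
    (Vs i != 0)%VS -> (Vs j != 0)%VS ->
    (A @: Vs i <= Vs m)%VS -> (A @: Vs j <= Vs m)%VS ->
  i = j.
Proof.
move=> nz_Vi nz_Vj AVi AVj; apply/eqP/negPn/negP => ne_ij.
have Vi_x := memv_pick (Vs i); have Vj_y := memv_pick (Vs j).
set x := vpick _ in Vi_x; set y := vpick _ in Vj_y.
have nz_Ax : A x != 0.
  by rewrite -(linear0 A) (inj_eq structure_group_inj) vpick0.
have [z w|c] := block_annihilator_line (subvP AVi _ (memv_img A Vi_x))
    (subvP AVj _ (memv_img A Vj_y)) nz_Ax.
  move: z w; apply/structure_group_annihilator => z w.
  by apply: R_cross ne_ij Vi_x Vj_y.
rewrite -linearZ => /structure_group_inj def_y.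
case/negP: nz_Vj; rewrite -vpick0; apply/eqP/(block_cap0 ne_ij) => //.
by rewrite -/y def_y memvZ.
Qed.

End CanonicalBlocks.

End BlockDecomposition.

Theorem theorem1p6 (K : realType) (V : vectType K) (R : form4 V) (k : nat)
    (Vs : 'I_k -> {vspace V})
    (phi : forall i : 'I_k, {symmetric (subvs_of (Vs i))})
    (hsum : model_direct_sum R (fun i => curv_of (phi i)))
    (hker : curv_ker R = [set 0])
    (A : 'End(V)) (hA : structure_group R A) :
  exists s : 'S_k, forall i : 'I_k, (A @: Vs i <= Vs (s i))%VS.
Proof.
case: hsum => R_curv [sumVs _] dim_Vs R_cross R_phi.
have ker0 v : (forall x y z, R v x y z = 0) -> v = 0.
  by move=> v_ker; have : curv_ker R v by []; rewrite hker.
have nz_Vs i : (Vs i != 0)%VS by rewrite -dimv_eq0 -lt0n.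
have [s AVs] := fin_all_exists
  (structure_group_block R_curv sumVs R_cross ker0 R_phi hA).
have s_inj : injective s.
  move=> i j eq_s; apply: (structure_group_block_inj R_curv sumVs R_cross ker0
    R_phi hA (nz_Vs i) (nz_Vs j) (AVs i)).
  by rewrite eq_s.
by exists (perm s_inj) => i; rewrite permE.
Qed.
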